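(* Let $G$ be a finite simple connected graph with at least one edge. Then $G$ induces a $3$-periodic Grover walk if and only if $G$ is isomorphic to the cycle graph $C_3$, and $G$ induces a $5$-periodic Grover walk if and only if $G$ is isomorphic to the cycle graph $C_5$.
   Context: Graphs are finite and simple (no loops, no multiple edges). $C_l$ denotes the cycle graph with $l$ vertices. For a graph $G$ with $m=|E(G)|$ edges, let $D(G)$ be the set of symmetric arcs of $G$: each edge $\{u,v\}\in E(G)$ gives the two arcs $(u,v)$ and $(v,u)$, so $|D(G)|=2m$. For an arc $e=(u,v)$ write $o(e)=u$, $t(e)=v$, $e^{-1}=(v,u)$. The Grover transfer matrix of $G$ is the $2m\times 2m$ matrix $U=U(G)=(U_{e,f})_{e,f\in D(G)}$ with $$U_{e,f}=\begin{cases}2/\deg(t(f)) & \text{if } t(f)=o(e) \text{ and } f\neq e^{-1},\\ 2/\deg(t(f))-1 & \text{if } f=e^{-1},\\ 0 & \text{otherwise.}\end{cases}$$ For a positive integer $k$, $G$ is said to induce a $k$-periodic Grover walk if $U^k=I_{2m}$ and $U^j\neq I_{2m}$ for every integer $j$ with $1\le j<k$. *)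

(* Defs.v *)
From mathcomp Require Import all_boot all_order all_algebra.

Set Implicit Arguments.
Unset Strict Implicit.
Unset Printing Implicit Defensive.

Import GRing.Theory Num.Theory.
Local Open Scope ring_scope.

(* A graph is its adjacency relation on a finite type of vertices. *)
Definition simple_graph (V : finType) (adj : rel V) : Prop :=
  symmetric adj /\ irreflexive adj.

Definition connected_graph (V : finType) (adj : rel V) : Prop :=
  (0 < #|V|)%N /\ forall u v : V, connect adj u v.

Definition graph_iso (V W : finType) (adjV : rel V) (adjW : rel W) : Prop :=
  exists f : V -> W,
    bijective f /\ forall u v : V, adjW (f u) (f v) = adjV u v.

(* ordS is the successor modulo l; this is the simple graph C_l only for
   l >= 3 (there is a loop when l = 1 and a single edge when l = 2). *)
Definition cycle_graph (l : nat) : rel 'I_l :=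
  [rel i j | (j == ordS i) || (i == ordS j)].

Arguments cycle_graph l : clear implicits.

Section Grover.

Variables (V : finType) (adj : rel V).

Definition degree (v : V) : nat := #|[set w | adj v w]|.

(* For symmetric adj, each edge {u, v} gives the two arcs (u, v), (v, u). *)
Definition sym_arc : Type := {a : V * V | adj a.1 a.2}.

Definition origin (a : sym_arc) : V := (val a).1.
Definition terminus (a : sym_arc) : V := (val a).2.

(* f is the inverse arc of e. *)
Definition is_inverse_arc (e f : sym_arc) : bool :=
  val f == (terminus e, origin e).

Definition grover_entry (R : numFieldType) (e f : sym_arc) : R :=
  if (terminus f == origin e) && ~~ is_inverse_arc e f
  then 2 / (degree (terminus f))%:R
  else if is_inverse_arc e f then 2 / (degree (terminus f))%:R - 1
  else 0.

Definition grover_matrix (R : numFieldType) : 'M[R]_#|{: sym_arc}| :=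
  \matrix_(i, j) grover_entry R (enum_val i) (enum_val j).

End Grover.

Definition periodic_grover_walk (R : numFieldType) (V : finType) (adj : rel V)
    (k : nat) : Prop :=
  [/\ (0 < k)%N,
      grover_matrix adj R ^+ k = 1%:M
    & forall j : nat, (1 <= j < k)%N -> grover_matrix adj R ^+ j <> 1%:M].

(* Main.v *)
Require Import Defs.
From mathcomp Require Import all_boot all_order all_algebra.
From mathcomp Require Import ring zify.

Set Implicit Arguments.
Unset Strict Implicit.
Unset Printing Implicit Defensive.

Import GRing.Theory Num.Theory.
Local Open Scope ring_scope.

(* Let S be the flip e |-> e^-1, so that S and S U are involutions. If U^k = 1
   with k odd, S is conjugate to S U, and comparing traces gives
   0 = 2 |V| - 2 |E|, i.e. the average degree is 2. If moreover an arc f starts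
   at a leaf, then U^((k-1)/2) f is invariant under S; for k = 3 and k = 5 this
   forces a degree-2 path from the leaf that can never turn back, which is
   absurd. So the graph is 2-regular, U permutes the arcs by the
   non-backtracking step, and the closed walk of length k followed by an arc
   runs around the whole graph. *)

(** * Arcs, their reversal, and vertex degrees *)

Section Arcs.

Variables (V : finType) (adj : rel V).
Hypothesis adj_sym : symmetric adj.

Local Notation arc := (sym_arc adj).

Definition arc_of u v (uv : adj u v) : arc := exist _ (u, v) uv.

Lemma arc_adj (a : arc) : adj (origin a) (terminus a).
Proof. exact: valP a. Qed.

Lemma arc_adj_rev (a : arc) : adj (terminus a) (origin a).
Proof. by rewrite adj_sym arc_adj. Qed.

Definition arc_rev (a : arc) : arc := arc_of (arc_adj_rev a).

Lemma arc_eqE (a b : arc) :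
  (a == b) = (origin a == origin b) && (terminus a == terminus b).
Proof. by []. Qed.

Lemma arc_revK : involutive arc_rev.
Proof. by move=> a; apply: val_inj; rewrite /= [RHS]surjective_pairing. Qed.

Lemma origin_rev a : origin (arc_rev a) = terminus a. Proof. by []. Qed.

Lemma terminus_rev a : terminus (arc_rev a) = origin a. Proof. by []. Qed.

Lemma is_inverse_arcE (e f : arc) : is_inverse_arc e f = (f == arc_rev e).
Proof. by []. Qed.

Lemma card_arcs_into (v : V) :
  #|[set a : arc | terminus a == v]| = degree adj v.
Proof.
rewrite /degree.
have inj : {in [set a : arc | terminus a == v] &, injective (@origin V adj)}.
  move=> a b; rewrite !inE => /eqP ta /eqP tb ab.
  by apply/eqP; rewrite arc_eqE ab ta tb !eqxx.
rewrite -(card_in_imset inj); apply: eq_card => w; rewrite inE.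
apply/imsetP/idP => [[a]|vw].
  by rewrite inE => /eqP <- ->; apply: arc_adj_rev.
have wv : adj w v by rewrite adj_sym.
by exists (arc_of wv) => //; rewrite inE.
Qed.

Lemma degree_ge2P v : reflect (exists x y, [/\ adj v x, adj v y & x != y])
  (1 < degree adj v)%N.
Proof.
apply: (iffP card_gt1P) => -[x [y]].
  by rewrite !inE => -[vx vy xy]; exists x, y.
by move=> [vx vy xy]; exists x, y; rewrite !inE.
Qed.

Lemma degree_ge2_other v u :
  (1 < degree adj v)%N -> exists2 w, adj v w & w != u.
Proof.
move=> /degree_ge2P[x [y [vx vy xy]]].
by have [xu|] := eqVneq x u; [exists y; rewrite // -xu eq_sym|exists x].
Qed.

Lemma degree2_adjE v u w : degree adj v = 2 -> adj v u -> adj v w -> w != u ->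
  forall y, adj v y = (y == u) || (y == w).
Proof.
move=> d2 vu vw wu y.
have sub : [set u; w] \subset [set y | adj v y].
  by apply/subsetP => z; rewrite !inE => /orP[] /eqP->.
have /eqP E : [set u; w] == [set y | adj v y].
  by rewrite eqEcard sub cards2 eq_sym wu -/(degree adj v) d2.
by move/setP: E => /(_ y); rewrite !inE => ->.
Qed.

(** * The Grover matrix as a kernel on arcs *)

Section Walk.

Variable R : numFieldType.

Local Notation U := (grover_matrix adj R).
Local Notation entry := (@grover_entry V adj R).

(** An inverse arc of [e] ends at [origin e], so the two nonzero cases merge into the uniform coin
    term minus a correction for the flip. *)
Lemma grover_entryE e f : entry e f =
  (terminus f == origin e)%:R * (2 / (degree adj (origin e))%:R)
  - (f == arc_rev e)%:R.
Proof.
rewrite /grover_entry is_inverse_arcE.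
have [->|fe] := eqVneq f (arc_rev e); first by rewrite andbF /= eqxx mul1r.
rewrite andbT; case: eqP => [->|_]; first by rewrite mul1r subr0.
by rewrite mul0r subr0.
Qed.

(** This is the symmetry of the matrix [U * flip_mx]; it lets a column at a leaf be read off as a
    row. *)
Lemma grover_entry_rev e f : entry e (arc_rev f) = entry f (arc_rev e).
Proof.
rewrite !grover_entryE !terminus_rev !(inj_eq (inv_inj arc_revK)).
rewrite [e == f]eq_sym [origin e == _]eq_sym.
by case: eqP => [->|_] //; rewrite !mul0r.
Qed.

Lemma grover_entry0 e f : terminus f != origin e -> entry e f = 0.
Proof.
move=> fe; rewrite grover_entryE arc_eqE terminus_rev (negPf fe) andbF.
by rewrite mul0r subrr.
Qed.

Definition arc_mx (F : arc -> arc -> R) : 'M[R]_#|{: arc}| :=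
  \matrix_(i, j) F (enum_val i) (enum_val j).

Lemma sum_arcs (F : arc -> R) :
  \sum_(i < #|{: arc}|) F (enum_val i) = \sum_a F a.
Proof. by rewrite [RHS](reindex _ (onW_bij _ (enum_val_bij arc))). Qed.

Lemma arc_mxM F G :
  arc_mx F * arc_mx G = arc_mx (fun e f => \sum_g F e g * G g f).
Proof.
apply/matrixP => i j; rewrite !mxE -sum_arcs.
by apply: eq_bigr => k _; rewrite !mxE.
Qed.

Lemma arc_mx_inj F G : arc_mx F = arc_mx G -> forall e f, F e f = G e f.
Proof.
move=> /matrixP FG e f.
by have := FG (enum_rank e) (enum_rank f); rewrite !mxE !enum_rankK.
Qed.

Lemma eq_arc_mx F G : (forall e f, F e f = G e f) -> arc_mx F = arc_mx G.
Proof. by move=> FG; apply/matrixP => i j; rewrite !mxE FG. Qed.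

Lemma arc_mx1 : arc_mx (fun e f => (e == f)%:R) = 1%:M.
Proof. by apply/matrixP => i j; rewrite !mxE (inj_eq enum_val_inj). Qed.

Lemma tr_arc_mx F : \tr (arc_mx F) = \sum_a F a a.
Proof. by rewrite -sum_arcs; apply: eq_bigr => i _; rewrite mxE. Qed.

Definition flip_mx := arc_mx (fun e f => (f == arc_rev e)%:R).

Lemma sum_pred1l (h : arc -> R) a : \sum_g (g == a)%:R * h g = h a.
Proof.
rewrite (bigD1 a) //= eqxx mul1r big1 ?addr0 // => g /negPf ->.
by rewrite mul0r.
Qed.

Lemma flip_mxM F : flip_mx * arc_mx F = arc_mx (fun e f => F (arc_rev e) f).
Proof. by rewrite arc_mxM; apply: eq_arc_mx => e f; rewrite sum_pred1l. Qed.

Lemma arc_mxM_flip F : arc_mx F * flip_mx = arc_mx (fun e f => F e (arc_rev f)).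
Proof.
rewrite arc_mxM; apply: eq_arc_mx => e f; rewrite -[RHS]sum_pred1l.
apply: eq_bigr => g _; rewrite mulrC; congr (_%:R * _).
by rewrite -(inj_eq (inv_inj arc_revK)) arc_revK eq_sym.
Qed.

(** * Reflections and the trace identity *)

Hypothesis degree_gt0 : forall v, (0 < degree adj v)%N.

Lemma degree_neq0 v : (degree adj v)%:R != 0 :> R.
Proof. by rewrite pnatr_eq0 -lt0n. Qed.

(* The walk is the product of two reflections, the flip and the coin
   [flip * U]; this identity says that the coin is an involution. *)
Lemma grover_flip_grover : U * flip_mx * U = flip_mx.
Proof.
rewrite -mulrA flip_mxM arc_mxM; apply: eq_arc_mx => e f.
set v := origin e; set d := (degree adj v)%:R : R.
have d0 : d != 0 := degree_neq0 v.
transitivity (\sum_(g : arc) (terminus g == v)%:R * (2 / d * entry (arc_rev g) f)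
   - \sum_g (g == arc_rev e)%:R * entry (arc_rev g) f).
  rewrite -sumrB; apply: eq_bigr => g _.
  by rewrite grover_entryE -/v -/d; ring.
rewrite sum_pred1l arc_revK.
transitivity ((\sum_(g : arc | terminus g == v) 2 / d *
      ((terminus f == v)%:R * (2 / d)))
   - \sum_(g : arc) (g == f)%:R * ((terminus g == v)%:R * (2 / d)) - entry e f).
  congr (_ - _); rewrite [in RHS]big_mkcond -sumrB; apply: eq_bigr => g _.
  rewrite grover_entryE arc_revK origin_rev [f == g]eq_sym.
  by case: (eqVneq (terminus g) v) => [->|_]; rewrite -/d /=; ring.
(* When [f] ends at [v], the [d] arcs into [v] contribute [d * (2/d)^2 = 4/d], which cancels the two
   remaining terms [2/d]; only the flip term survives. *)
rewrite sum_pred1l sumr_const.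
have -> : #|[pred g : arc | terminus g == v]| = degree adj v.
  by rewrite -card_arcs_into; apply: eq_card => g; rewrite inE.
rewrite grover_entryE -/v -/d -mulr_natr -/d.
by field.
Qed.

Lemma grover_pow_flip r : U ^+ r * flip_mx * U ^+ r = flip_mx.
Proof.
elim: r => [|r IH]; first by rewrite expr0 mul1r mulr1.
transitivity (U ^+ r * (U * flip_mx * U) * U ^+ r).
  by rewrite {1}exprSr exprS !mulrA.
by rewrite grover_flip_grover.
Qed.

(* An odd period makes the two reflections similar: their traces agree. *)
Lemma odd_period_sum_degree r : irreflexive adj -> U ^+ r.*2.+1 = 1 ->
  \sum_v (2 - (degree adj v)%:R : R) = 0.
Proof.
move=> irr Uk.
have tr_flip : \tr flip_mx = 0.
  rewrite tr_arc_mx big1 // => a _; rewrite arc_eqE.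
  case: andP => // -[/eqP ota _]; have := arc_adj a.
  by rewrite {1}ota origin_rev irr.
(* With S the flip, [S = U^(r+1) S U^(r+1)], and cyclicity of the trace gives
   [tr S = tr (S U^(2r+2)) = tr (S U)]. *)
have tr_coin : \tr (flip_mx * U) = 0.
  rewrite -{}tr_flip -[in RHS](grover_pow_flip r.+1) -mulrA -[in RHS]mulmxE.
  rewrite [in RHS]mxtrace_mulC mulmxE -mulrA -exprD addSn addnS addnn.
  by rewrite exprSr Uk mul1r.
rewrite -[RHS]tr_coin flip_mxM tr_arc_mx.
rewrite [RHS] (partition_big (@terminus V adj) predT) //=.
apply: eq_bigr => v _.
(* Grouped by terminus, a vertex of degree d carries d diagonal entries [2/d - 1], in total
   [2 - d]. *)
transitivity (\sum_(a : arc | terminus a == v) (2 / (degree adj v)%:R - 1 : R)).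
  rewrite sumr_const -mulr_natr.
  have -> : #|[pred a : arc | terminus a == v]| = degree adj v.
    by rewrite -card_arcs_into; apply: eq_card => g; rewrite inE.
  by field; rewrite degree_neq0.
apply: eq_big => [//|a /eqP <-].
by rewrite grover_entryE arc_revK !eqxx mul1r.
Qed.

(** * Exclusion of leaves for periods 3 and 5 *)

Hypothesis adj_irr : irreflexive adj.

Lemma terminus_neq_origin (a : arc) : terminus a != origin a.
Proof.
by apply/eqP => E; have := arc_adj a; rewrite E adj_irr.
Qed.

(** The only arc ending at a leaf is the inverse of the one starting there, and the coin entry is
    [2/1 - 1 = 1]: total reflection. *)
Lemma grover_entry_leaf f g :
  degree adj (origin f) = 1 -> entry f g = (g == arc_rev f)%:R.
Proof.
move=> d1; rewrite grover_entryE d1 arc_eqE terminus_rev origin_rev.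
case: (eqVneq (terminus g) (origin f)) => [tg|_]; last first.
  by rewrite andbF mul0r subrr.
rewrite andbT.
have /eqP/cards1P[x Ex] := d1.
have -> : origin g = terminus f.
  have : origin g \in [set w | adj (origin f) w].
    by rewrite inE -tg adj_sym arc_adj.
  have : terminus f \in [set w | adj (origin f) w] by rewrite inE arc_adj.
  by rewrite Ex !inE => /eqP -> /eqP.
by rewrite eqxx /=; field.
Qed.

(** In degree 2 the reflected amplitude is [2/2 - 1 = 0] and the transmitted one is [2/2 = 1]. *)
Lemma grover_entry_degree2 e f g : degree adj (terminus f) = 2 ->
  origin g = terminus f -> terminus g != origin f ->
  entry e f = (e == g)%:R.
Proof.
move=> d2 og tg; rewrite grover_entryE !arc_eqE origin_rev terminus_rev.
rewrite og [origin e == _]eq_sym.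
case: eqP => [E|_]; last by rewrite andbF mul0r subrr.
rewrite -E d2 mul1r divff ?pnatr_eq0 // andbT.
have fo : adj (terminus f) (origin f) by rewrite adj_sym arc_adj.
have fg : adj (terminus f) (terminus g) by rewrite -og arc_adj.
have fe : adj (terminus f) (terminus e) by rewrite E arc_adj.
have := degree2_adjE d2 fo fg tg (terminus e).
rewrite fe [origin f == _]eq_sym.
have [->|_ /= <-] := eqVneq (terminus e) (origin f); last by rewrite subr0.
by rewrite eq_sym (negPf tg) subrr.
Qed.

(** Writing S for the flip, [S = U^r S U^r] and [U^(2r+1) = 1] give [S U^r = U^r (U S)]. Since [U S]
    fixes the basis vector of an arc [f] leaving a leaf, column [f] of [U^r] is invariant under
    S. *)
Lemma leaf_grover_pow_flip r F f : U ^+ r.*2.+1 = 1 -> U ^+ r = arc_mx F ->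
  degree adj (origin f) = 1 -> forall e, F (arc_rev e) f = F e f.
Proof.
move=> Uk UF d1 e.
have : flip_mx * U ^+ r = U ^+ r * (U * flip_mx).
  rewrite mulrA -exprSr -[in RHS](grover_pow_flip r) !mulrA -exprD.
  by rewrite addSn addnn Uk mul1r.
rewrite UF flip_mxM arc_mxM_flip arc_mxM => /arc_mx_inj ->.
rewrite -[RHS]sum_pred1l; apply: eq_bigr => g _; rewrite mulrC; congr (_ * _).
by rewrite grover_entry_rev grover_entry_leaf // (inj_eq (inv_inj arc_revK)).
Qed.

(** Comparing the entries at [f] and its inverse gives [2/d - 1 = 0], so the walk is fully
    transmitted at [terminus f]. The column is then 1 at the onward arc but 0 at its inverse. *)
Lemma grover_column_flip f :
  (forall e, entry (arc_rev e) f = entry e f) -> False.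
Proof.
move=> inv.
have d2 : degree adj (terminus f) = 2.
  have := inv f; rewrite !grover_entryE origin_rev arc_revK !eqxx.
  rewrite arc_eqE origin_rev [origin f == _]eq_sym.
  rewrite (negPf (terminus_neq_origin f)) mul1r mul0r subrr => /eqP.
  rewrite subr_eq0 -(inj_eq (mulIf (degree_neq0 (terminus f)))).
  by rewrite mul1r divfK ?degree_neq0 // eqr_nat => /eqP.
have [|w fw wf] := @degree_ge2_other (terminus f) (origin f); first by rewrite d2.
have := inv (arc_of fw).
rewrite !(@grover_entry_degree2 _ f (arc_of fw)) // eqxx arc_eqE.
rewrite origin_rev (negPf (terminus_neq_origin (arc_of fw))) => /eqP.
by rewrite eq_sym oner_eq0.
Qed.

Lemma period3_degree_ge2 : U ^+ 3 = 1 -> forall v, (1 < degree adj v)%N.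
Proof.
move=> U3 v; rewrite ltn_neqAle degree_gt0 andbT eq_sym; apply/eqP => d1.
have /card_gt0P[u] := degree_gt0 v; rewrite inE => vu.
by apply: (@grover_column_flip (arc_of vu)); exact: (@leaf_grover_pow_flip 1 entry).
Qed.

Lemma period5_degree_ge2 : U ^+ 5 = 1 -> forall v, (1 < degree adj v)%N.
Proof.
move=> U5 v; rewrite ltn_neqAle degree_gt0 andbT eq_sym; apply/eqP => d1.
have /card_gt0P[u] := degree_gt0 v; rewrite inE => vu.
set f := arc_of vu.
have inv e : \sum_g entry (arc_rev e) g * entry g f = \sum_g entry e g * entry g f.
  apply: (@leaf_grover_pow_flip 2 (fun e f => \sum_g entry e g * entry g f)) => //.
  by rewrite -arc_mxM expr2.
(* Compare the entries of [U^2] at [f] and its inverse. Returning to [f] means reflecting at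
   [terminus f] and then at the leaf, with amplitude [2/d - 1]; reaching the inverse of [f] in two
   steps would require a loop, so that entry is 0. *)
have d2 : degree adj (terminus f) = 2.
  have := inv f.
  under [in RHS]eq_bigr do rewrite grover_entry_leaf //.
  rewrite sum_pred1l grover_entryE origin_rev arc_revK !eqxx mul1r.
  rewrite big1 => [/esym/eqP|g _].
    rewrite subr_eq0 -(inj_eq (mulIf (degree_neq0 (terminus f)))).
    by rewrite mul1r divfK ?degree_neq0 // eqr_nat => /eqP.
  have [tg|/grover_entry0->] := eqVneq (terminus f) (origin g).
    by rewrite grover_entry0 ?mul0r // origin_rev tg terminus_neq_origin.
  by rewrite mulr0.
have [|w fw wf] := @degree_ge2_other (terminus f) (origin f); first by rewrite d2.
(* By full transmission, column [f] of [U^2] is the column of [U] at the onward arc. *)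
apply: (@grover_column_flip (arc_of fw)) => e; have := inv e.
under eq_bigr do rewrite (@grover_entry_degree2 _ f (arc_of fw)) // mulrC.
under [in RHS]eq_bigr do rewrite (@grover_entry_degree2 _ f (arc_of fw)) // mulrC.
by rewrite !sum_pred1l.
Qed.

(** Without leaves all terms [degree - 2] are nonnegative, and their sum is zero. *)
Lemma odd_period_2regular r : U ^+ r.*2.+1 = 1 ->
  (forall v, (1 < degree adj v)%N) -> forall v, degree adj v = 2.
Proof.
move=> Uk ge2 v.
have := odd_period_sum_degree adj_irr Uk => /eqP.
rewrite -oppr_eq0 -sumrN psumr_eq0 => [/allP/(_ v)|w _].
  by rewrite mem_index_enum oppr_eq0 subr_eq0 eqr_nat => /(_ isT)/eqP.
by rewrite opprB subr_ge0 ler_nat.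
Qed.

End Walk.

(** * The walk on a 2-regular graph as non-backtracking motion *)

Definition arc_step (t : arc -> arc) :=
  forall a, origin (t a) = terminus a /\ terminus (t a) != origin a.

Hypothesis regular2 : forall v, degree adj v = 2.

Lemma exists_arc_step : exists t, arc_step t.
Proof.
apply: (@fin_all_exists _ (fun=> arc) (fun a b =>
  origin b = terminus a /\ terminus b != origin a)) => a.
have [|w aw wa] := @degree_ge2_other (terminus a) (origin a).
  by rewrite regular2.
by exists (arc_of aw).
Qed.

(** Full transmission at every vertex makes [U] send the basis vector of [f] to that of [t f]. *)
Lemma grover_pow_step (R : numFieldType) t j : arc_step t ->
  grover_matrix adj R ^+ j = arc_mx (fun e f => (e == iter j t f)%:R).
Proof.
move=> tP; elim: j => [|j IH]; first by rewrite expr0 arc_mx1.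
rewrite exprSr IH [grover_matrix _ _]/(arc_mx _) arc_mxM.
apply: eq_arc_mx => e f.
rewrite iterSr -[RHS](sum_pred1l (fun g => (e == iter j t g)%:R)).
apply: eq_bigr => g _; rewrite mulrC; congr (_ * _).
by have [] := tP f; apply: grover_entry_degree2.
Qed.

Lemma grover_pow_eq1 (R : numFieldType) t j : arc_step t ->
  grover_matrix adj R ^+ j = 1%:M <-> forall a, iter j t a = a.
Proof.
move=> tP; rewrite (grover_pow_step _ _ tP) -arc_mx1; split=> [E a|E].
  have := arc_mx_inj E a a; rewrite eqxx.
  by have [<-|_ /eqP] := eqVneq a; rewrite // eq_sym oner_eq0.
by apply: eq_arc_mx => e f; rewrite E.
Qed.

Lemma step_adjE t a w : arc_step t ->
  adj (terminus a) w = (w == origin a) || (w == terminus (t a)).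
Proof.
move=> tP; have [ot tt] := tP a; apply: degree2_adjE => //.
  by rewrite adj_sym arc_adj.
by rewrite -ot arc_adj.
Qed.

End Arcs.

(** * A closed walk exhausting a connected graph *)

Section ClosedWalk.

Variables (V : finType) (adj : rel V) (k : nat) (x : nat -> V).
Hypothesis connected : forall u v, connect adj u v.
Hypothesis adj_x : forall i w, adj (x i.+1) w = (w == x i) || (w == x i.+2).
Hypothesis x_period : forall i, x (i + k)%N = x i.
Hypothesis x_neq : forall i d, (0 < d < k)%N -> x (i + d) != x i.
Hypothesis k_gt1 : (1 < k)%N.

Lemma walk_modn i : x (i %% k)%N = x i.
Proof.
rewrite [in RHS](divn_eq i k) addnC; elim: (i %/ k)%N => [|q IH].
  by rewrite addn0.
by rewrite mulSn addnA addnAC x_period.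
Qed.

Lemma walk_eq i j : (x i == x j) = (i == j %[mod k])%N.
Proof.
have k0 : (0 < k)%N by apply: ltnW.
apply/eqP/eqP => [|E]; last by rewrite -walk_modn E walk_modn.
rewrite -(walk_modn i) -(walk_modn j).
have := ltn_pmod i k0; have := ltn_pmod j k0.
move: (i %% k)%N (j %% k)%N => {}i {}j.
wlog ij : i j / (i <= j)%N => [wl jk ik E|jk ik xij].
  by case/orP: (leq_total i j) => ?; [|symmetry]; apply: wl.
apply/eqP; move/eqP: xij; apply: contraTT => ne.
by rewrite eq_sym -(subnKC ij); apply: x_neq; lia.
Qed.

(** All neighbours of a walk vertex lie on the walk, so no path from [x 0] can leave it. *)
Lemma walk_surj w : exists i, w = x i.
Proof.
have /connectP[p] := connected (x 0%N) w; elim: p 0%N => [|u p IH] i /=.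
  by move=> _ ->; exists i.
(* Shifting the index by a full period turns it into a successor, so that [adj_x] applies even at
   index 0. *)
rewrite -x_period -(prednK (ltnW k_gt1)) addnS adj_x => /andP[/orP[]/eqP->].
  exact: IH.
exact: IH.
Qed.

Lemma walk_adjE i j :
  adj (x i) (x j) = (j == i.+1 %[mod k])%N || (i == j.+1 %[mod k])%N.
Proof.
have k0 : (0 < k)%N by apply: ltnW.
have Ei : x (i + k.-1).+1 = x i by rewrite -addnS prednK.
rewrite -{1}Ei adj_x orbC !walk_eq -addnS prednK // -addSn modnDr.
(* The predecessor of [i] modulo [k] appears as [i + k.-1]; adding 1 to both sides removes it. *)
congr (_ || _); rewrite eq_sym -(eqn_modDr 1 _ j) -addnA addn1 prednK //.
by rewrite modnDr addn1.
Qed.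

Lemma closed_walk_iso : graph_iso adj (cycle_graph k).
Proof.
have k0 : (0 < k)%N by apply: ltnW.
pose f (i : 'I_k) := x i.
have f_inj : injective f.
  move=> i j /eqP; rewrite /f walk_eq !modn_small // => /eqP; exact: val_inj.
have f_surj w : exists i, f i == w.
  have [i ->] := walk_surj w; exists (Ordinal (ltn_pmod i k0)).
  by rewrite /f walk_modn.
pose g w := xchoose (f_surj w).
have gK : cancel g f by move=> w; apply/eqP/(xchooseP (f_surj w)).
have fK : cancel f g by move=> i; apply: f_inj; rewrite gK.
exists g; split; first by exists f.
move=> u v; rewrite -{2}(gK u) -{2}(gK v).
by rewrite /f walk_adjE /cycle_graph /= -!val_eqE /= !(modn_small (ltn_ord _)).
Qed.

End ClosedWalk.

(** * Rotation of the vertices of a cycle *)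

Section CycleGraph.

Variable k : nat.
Implicit Types i j : 'I_k.

Lemma iter_ordS n i : iter n (@ordS k) i = ((i + n) %% k)%N :> nat.
Proof.
elim: n => [|n IH]; first by rewrite addn0 modn_small.
by rewrite iterS /= IH -addn1 modnDml addn1 addnS.
Qed.

Lemma iter_ordS_id i : iter k (@ordS k) i = i.
Proof. by apply: val_inj; rewrite /= iter_ordS modnDr modn_small. Qed.

Lemma iter_ordS_neq n i : (0 < n < k)%N -> iter n (@ordS k) i != i.
Proof.
move=> nk; rewrite -val_eqE /= iter_ordS.
apply/eqP => E; have := divn_eq (i + n) k; rewrite E.
have := ltn_ord i; case: (_ %/ _)%N => [|q]; rewrite ?mulSn; lia.
Qed.

Lemma ordS_inj : injective (@ordS k).
Proof. exact: can_inj (@ordSK k). Qed.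

End CycleGraph.

(** * Period of the arc step on a cycle *)

Section IsoCycle.

Variables (V : finType) (adj : rel V) (k : nat) (f : V -> 'I_k) (g : 'I_k -> V).
Hypothesis k_gt2 : (2 < k)%N.
Hypothesis adj_sym : symmetric adj.
Hypotheses (fK : cancel f g) (gK : cancel g f).
Hypothesis fP : forall u v, cycle_graph k (f u) (f v) = adj u v.

Lemma iso_cycle_regular2 v : degree adj v = 2.
Proof.
rewrite /degree.
have -> : [set w | adj v w] = [set g (ordS (f v)); g (ord_pred (f v))].
  apply/setP => w; rewrite !inE -fP /cycle_graph /= -!(inj_eq (can_inj fK)) !gK.
  by rewrite -(inj_eq (@ordS_inj k) (f w) (ord_pred (f v))) ord_predK [ordS _ == f v]eq_sym.
(* Successor and predecessor differ because two rotations are not the identity when [k > 2]. *)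
rewrite cards2 (inj_eq (can_inj gK)) -(inj_eq (@ordS_inj k)) ord_predK.
by rewrite (@iter_ordS_neq k 2).
Qed.

Local Notation arc := (sym_arc adj).

Variable t : arc -> arc.
Hypothesis tP : arc_step t.

(** An arc in the direction of [ordS] keeps that direction, since reversing it would be a
    backtrack. *)
Lemma arc_step_forward n a : f (terminus a) = ordS (f (origin a)) ->
  f (origin (iter n t a)) = iter n (@ordS k) (f (origin a)) /\
  f (terminus (iter n t a)) = iter n.+1 (@ordS k) (f (origin a)).
Proof.
move=> fa; elim: n => [|n [IHo IHt]]; first by [].
rewrite iterS; set b := iter n t a in IHo IHt *.
have [otb ttb] := tP b; rewrite otb; split=> //.
have := arc_adj (t b); rewrite -fP /cycle_graph /= otb IHt => /orP[]/eqP // /ordS_inj E.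
by case/negP: ttb; rewrite -(inj_eq (can_inj fK)) IHo -E.
Qed.

(** Rotating the later vertex forward to the starting one avoids iterating [ord_pred]. *)
Lemma arc_step_backward n a : f (origin a) = ordS (f (terminus a)) ->
  iter n (@ordS k) (f (origin (iter n t a))) = f (origin a) /\
  f (origin (iter n t a)) = ordS (f (terminus (iter n t a))).
Proof.
move=> fa; elim: n => [|n [IH fb]]; first by [].
rewrite iterSr [iter n.+1 t a]iterS; set b := iter n t a in IH fb *.
have [otb ttb] := tP b; rewrite otb -fb; split=> //.
have := arc_adj (t b); rewrite -fP /cycle_graph /= otb => /orP[]/eqP // E.
by case/negP: ttb; rewrite -(inj_eq (can_inj fK)) E -fb.
Qed.

Lemma iso_cycle_step_period n : (0 < #|{: arc}|)%N -> (0 < n <= k)%N ->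
  (forall a, iter n t a = a) <-> n = k.
Proof.
move=> arc_gt0 nk; have dir (a : arc) : (f (terminus a) == ordS (f (origin a))) ||
    (f (origin a) == ordS (f (terminus a))).
  by have := arc_adj a; rewrite -fP.
split=> [E|-> a].
  apply/eqP; apply: contraT => n_neq; have nk' : (0 < n < k)%N by lia.
  have /card_gt0P[a _] := arc_gt0.
  case/orP: (dir a) => /eqP fa.
    have [] := arc_step_forward n fa; rewrite E => /esym/eqP.
    by rewrite (negPf (iter_ordS_neq _ nk')).
  have [] := arc_step_backward n fa; rewrite E => /eqP.
  by rewrite (negPf (iter_ordS_neq _ nk')).
apply/eqP; rewrite arc_eqE -!(inj_eq (can_inj fK)).
case/orP: (dir a) => /eqP fa.
  have [-> ->] := arc_step_forward k fa.
  by rewrite iterS iter_ordS_id fa !eqxx.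
have [] := arc_step_backward k fa; rewrite iter_ordS_id => -> E.
by rewrite eqxx -(inj_eq (@ordS_inj k)) -fa -E eqxx.
Qed.

End IsoCycle.

(** * Equivalence of periodicity and being a cycle *)

Lemma iso_cycle_periodic (R : numFieldType) (V : finType) (adj : rel V) k :
  (2 < k)%N -> simple_graph adj -> (exists u v, adj u v) ->
  graph_iso adj (cycle_graph k) -> periodic_grover_walk R adj k.
Proof.
move=> k_gt2 [adj_sym _] [u [v uv]] [f [[g fK gK] fP]].
have reg := iso_cycle_regular2 k_gt2 fK gK fP.
have [t tP] := exists_arc_step reg.
have arc_gt0 : (0 < #|{: sym_arc adj}|)%N.
  by apply/card_gt0P; exists (arc_of uv).
have per n nk := iso_cycle_step_period k_gt2 fK fP tP arc_gt0 (n := n) nk.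
have k0 : (0 < k)%N by lia.
split=> //.
  by apply/(grover_pow_eq1 adj_sym reg _ _ tP)/per; rewrite ?k0 /=.
move=> j jk /(grover_pow_eq1 adj_sym reg _ _ tP)/per; lia.
Qed.

(** The origins along the orbit of [a] form a closed walk. Indices at distance 1 are separated by
    the absence of loops, those at distance 2 by non-backtracking. *)
Lemma step_period_iso (V : finType) (adj : rel V) (a : sym_arc adj) t k :
  symmetric adj -> irreflexive adj -> (forall u v, connect adj u v) ->
  (forall v, degree adj v = 2) -> arc_step t -> k = 3 \/ k = 5 ->
  iter k t a = a -> graph_iso adj (cycle_graph k).
Proof.
move=> adj_sym adj_irr conn reg tP k35 tk.
pose x i := origin (iter i t a).
have xS i : x i.+1 = terminus (iter i t a) by rewrite /x iterS; case: (tP (iter i t a)).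
have per i : x (i + k)%N = x i by rewrite /x iterD tk.
have ne1 i : x i.+1 != x i by rewrite xS terminus_neq_origin.
have ne2 i : x i.+2 != x i by rewrite xS iterS; case: (tP (iter i t a)).
apply: (@closed_walk_iso _ _ k x) => //; last by case: k35 => ->.
  by move=> i w; rewrite !xS; apply: step_adjE.
(* modulo 3 or 5 every nonzero difference is 1, 2, -1 or -2 *)
move=> i d dk.
have [->|[->|[E|E]]] : d = 1 \/ d = 2 \/ k = d.+1 \/ k = d.+2 by lia.
- by rewrite addn1.
- by rewrite addn2.
- by rewrite -[x i]per E addnS eq_sym.
- by rewrite -[x i]per E !addnS eq_sym.
Qed.

Lemma connected_degree_gt0 (V : finType) (adj : rel V) :
  symmetric adj -> irreflexive adj -> (exists u v, adj u v) ->
  (forall u v, connect adj u v) -> forall v, (0 < degree adj v)%N.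
Proof.
move=> adj_sym adj_irr [u [w uw]] conn v.
have [<-|uv] := eqVneq u v.
  by apply/card_gt0P; exists w; rewrite inE.
have /connectP[[|y p]] := conn v u; first by move=> _ E; rewrite E eqxx in uv.
by move=> /andP[vy _] _; apply/card_gt0P; exists y; rewrite inE.
Qed.

Theorem theorem3p2 (R : numFieldType) (V : finType) (adj : rel V)
    (Gsimple : simple_graph adj) (Gconnected : connected_graph adj)
    (Gedge : exists u v : V, adj u v) :
  (periodic_grover_walk R adj 3 <-> graph_iso adj (cycle_graph 3)) /\
  (periodic_grover_walk R adj 5 <-> graph_iso adj (cycle_graph 5)).
Proof.
have [adj_sym adj_irr] := Gsimple; have [_ conn] := Gconnected.
have [u [v uv]] := Gedge.
have deg0 := connected_degree_gt0 adj_sym adj_irr Gedge conn.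
(* Both periods share this argument, with [r] equal to 1 or 2; only the exclusion of leaves is
   specific to each. *)
have iso r : r.*2.+1 = 3 \/ r.*2.+1 = 5 ->
    (forall v, (1 < degree adj v)%N) -> grover_matrix adj R ^+ r.*2.+1 = 1 ->
    graph_iso adj (cycle_graph r.*2.+1).
  move=> r35 ge2 Uk.
  have reg := odd_period_2regular adj_sym deg0 adj_irr Uk ge2.
  have [t tP] := exists_arc_step reg.
  apply: (@step_period_iso _ _ (arc_of uv) t) => //.
  exact: ((grover_pow_eq1 adj_sym reg R _ tP).1 Uk).
split; split; try exact: iso_cycle_periodic.
  move=> [_ U3 _]; apply: (iso 1) => //; first by left.
  exact: period3_degree_ge2 U3.
move=> [_ U5 _]; apply: (iso 2) => //; first by right.
exact: period5_degree_ge2 U5.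
Qed.
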